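(* Let $n,m,r\ge 1$ be integers, let $A\in\mathbb{R}^{m\times m}$ and $B,C\in\mathbb{R}^{m\times r}$, let $L\in\mathbb{R}^{n\times n}$ be a Laplacian matrix with eigenvalues $\lambda_1,\dots,\lambda_n$, and let $\chi(\lambda,\mu)=\det\big(A-\lambda BC^T-\mu I_m\big)$. Let $\overline{m}=\operatorname{rank}(BC^T)$, and let $\mu_{ij}$ and $\lambda_{ijk}$ be the associated numbers defined in the context. Assume that $\overline{m}=m$ and that there exists $i\in\{1,\dots,n\}$ such that, for all $j_1\neq j_2$ in $\{1,\dots,m\}$: - $\mu_{ij_1}\neq\mu_{ij_2}$ and both are nonzero; - $\{\lambda_{ij_1k}\}_{k=1}^{m}=\{\lambda_{ij_2k}\}_{k=1}^{m}$. Then $\chi(\lambda,\mu)$ does not admit cross terms of the form $\mu^s\lambda^t$ with $s>0$ and $t>0$, i.e. the coefficient of $\mu^s\lambda^t$ in the polynomial $\chi$ is zero for all integers $s>0$ and $t>0$.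
   Context: A Laplacian matrix is a matrix $L=D-W$ with $W\in\mathbb{R}^{n\times n}$ the (weighted) adjacency matrix of a network with $n$ nodes and $D=\operatorname{diag}(d_1,\dots,d_n)$, $d_i=\sum_{k=1}^n W_{ik}$. Its eigenvalues $\lambda_1,\dots,\lambda_n\in\mathbb{C}$ are listed with multiplicity. For each $i\in\{1,\dots,n\}$, $\mu_{i1},\dots,\mu_{im}\in\mathbb{C}$ denote the $m$ eigenvalues (with algebraic multiplicity) of $A-\lambda_i BC^T$, i.e. the roots $\mu$ of $\chi(\lambda_i,\mu)=0$; together, the $\mu_{ij}$ are the eigenvalues of $J=I_n\otimes A-L\otimes BC^T$. For each $i\in\{1,\dots,n\}$ and $j\in\{1,\dots,m\}$, $\lambda_{ijk}$, $k\in\{1,\dots,\overline{m}\}$, denote the solutions $\lambda\in\mathbb{C}$ of the generalized eigenvalue problem $(A-\mu_{ij}I_m)w=\lambda BC^Tw$ (with $w\neq0$), i.e. the roots of the polynomial $\lambda\mapsto\chi(\lambda,\mu_{ij})$, listed with multiplicity (when $\overline{m}=m$ this polynomial has degree exactly $m$); one of them is $\lambda_i$. The collections $\{\lambda_{ijk}\}_k$ are compared as multisets. *)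

(* Defs.v *)
From HB Require Import structures.
From mathcomp Require Import all_boot all_order all_algebra.
From mathcomp Require Import polyXY complex.
From mathcomp Require Import reals.

Set Implicit Arguments.
Unset Strict Implicit.
Unset Printing Implicit Defensive.

Import GRing.Theory.
Local Open Scope ring_scope.

(* W is an arbitrary real weight matrix: the network may be directed, signed,
   or have self-loops (the diagonal of W cancels out of the Laplacian). *)
Definition laplacian (R : pzRingType) (n : nat) (W : 'M[R]_n) : 'M[R]_n :=
  diag_mx (\row_i \sum_k W i k) - W.

Definition is_laplacian (R : pzRingType) (n : nat) (L : 'M[R]_n) : Prop :=
  exists W : 'M[R]_n, L = laplacian W.

Definition complexify (R : realType) (p q : nat) (M : 'M[R]_(p, q)) :
    'M[R[i]]_(p, q) :=
  map_mx (real_complex R) M.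

(* The entries of s are all the roots of p, repeated according to
   multiplicity. Meaningful for p != 0 only: every s lists the roots of 0. *)
Definition lists_roots (K : comNzRingType) (N : nat) (p : {poly K})
    (s : 'I_N -> K) : Prop :=
  p = lead_coef p *: \prod_(k < N) ('X - (s k)%:P).

Definition lists_eigenvalues (K : comNzRingType) (N : nat) (M : 'M[K]_N)
    (s : 'I_N -> K) : Prop :=
  lists_roots (char_poly M) s.

(* chi(lambda, mu) = det (A - lambda B C^T - mu I) as a bivariate polynomial.
   The outer variable 'X is mu and the inner variable 'Y (that is, 'X%:P) is
   lambda: (chi A B C)`_s`_t is the coefficient of mu^s lambda^t, and
   (chi A B C).[mu%:P] is the univariate polynomial lambda |-> chi(lambda, mu). *)
Definition chi (K : comNzRingType) (m r : nat) (A : 'M[K]_m)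
    (B C : 'M[K]_(m, r)) : {poly {poly K}} :=
  let const_coef := map_mx (fun x : K => x%:P%:P) in
  \det (const_coef A - 'Y *: const_coef (B *m C^T) - 'X%:M).

(* Main.v *)
(* The coefficient of lambda^t in chi is a polynomial in mu of degree at most
   m - t, because the entries of A - lambda B C^T - mu I have total degree at
   most 1. In particular the coefficient of lambda^m is constant, so the
   polynomials chi(_, mu_ij), having the same roots, coincide for all j. For
   t > 0 the coefficient of lambda^t is thus a polynomial of degree less than m
   taking one value at m distinct points, hence a constant. *)

Require Import Defs.
From HB Require Import structures.
From mathcomp Require Import all_boot all_order all_algebra.
From mathcomp Require Import polyXY complex.
From mathcomp Require Import reals.
From mathcomp Require Import zify.

Set Implicit Arguments.
Unset Strict Implicit.
Unset Printing Implicit Defensive.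

Import GRing.Theory.
Local Open Scope ring_scope.

(** Phrased by vanishing coefficients, so that the zero polynomial needs no degree convention. *)
Definition total_degree_le (K : nzSemiRingType) (d : nat)
    (p : {poly {poly K}}) : Prop :=
  forall s t, (d < s + t)%N -> p`_s`_t = 0.

Section TotalDegree.
Variable K : comNzRingType.
Implicit Types p q : {poly {poly K}}.

Lemma total_degree_leC (c : K) (d : nat) : total_degree_le d c%:P%:P.
Proof.
move=> s t; rewrite coefC; case: s => [|s] /=; last by rewrite coef0.
by rewrite add0n coefC; case: t.
Qed.

Lemma total_degree_leX : total_degree_le 1 ('X : {poly {poly K}}).
Proof.
move=> s t; rewrite coefX; case: eqP => [->|_]; last by rewrite coef0.
by rewrite coef1; case: t.
Qed.

Lemma total_degree_leY : total_degree_le 1 ('Y : {poly {poly K}}).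
Proof.
move=> s t; rewrite coefC; case: s => [|s] /=; last by rewrite coef0.
by rewrite add0n coefX; case: t => [|[]].
Qed.

Lemma total_degree_le_sum (I : Type) (r : seq I) (P : pred I)
    (F : I -> {poly {poly K}}) d :
  (forall i, P i -> total_degree_le d (F i)) ->
  total_degree_le d (\sum_(i <- r | P i) F i).
Proof.
by move=> FP s t dst; rewrite !coef_sum big1 // => i Pi; apply: FP.
Qed.

Lemma total_degree_leB p q d :
  total_degree_le d p -> total_degree_le d q -> total_degree_le d (p - q).
Proof. by move=> pP qP s t dst; rewrite !coefB pP ?qP ?subr0. Qed.

Lemma total_degree_leM p q d e :
  total_degree_le d p -> total_degree_le e q -> total_degree_le (d + e) (p * q).
Proof.
move=> pP qP s t dst; rewrite coefM coef_sum big1 // => i _.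
rewrite coefM big1 // => j _.
(* The exponents of the two factors add up to [s + t], which exceeds [d + e], so one factor is
   beyond its own bound. *)
have [dij|dij] := ltnP d (i + j); first by rewrite pP ?mul0r.
rewrite qP ?mulr0 //; have := ltn_ord i; have := ltn_ord j; lia.
Qed.

Lemma total_degree_le_det (m : nat) (M : 'M[{poly {poly K}}]_m) :
  (forall i j, total_degree_le 1 (M i j)) -> total_degree_le m (\det M).
Proof.
move=> MP; apply: total_degree_le_sum => u _.
(* In the Leibniz expansion the sign becomes a constant of degree 0; writing [m] as a sum of [m]
   ones then bounds the product of entries factor by factor. *)
rewrite -(rmorph_sign polyC) -(rmorph_sign (@polyC K)).
rewrite -[m in total_degree_le m]add0n.
apply: total_degree_leM; first exact: total_degree_leC.
rewrite -[m in total_degree_le m]card_ord -sum1_card.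
elim/big_ind2: _ => //; first exact: (total_degree_leC 1).
by move=> p d q e pP qP; apply: total_degree_leM.
Qed.

Lemma total_degree_le_chi (m r : nat) (A : 'M[K]_m) (B C : 'M[K]_(m, r)) :
  total_degree_le m (chi A B C).
Proof.
apply: total_degree_le_det => i j; rewrite !mxE.
apply: total_degree_leB; first apply: total_degree_leB.
- exact: total_degree_leC.
- rewrite -[1%N]addn0; apply: total_degree_leM; first exact: total_degree_leY.
  exact: total_degree_leC.
- case: eqP => _; last exact: (total_degree_leC 0).
  exact: total_degree_leX.
Qed.

(** After the swap, the coefficient of lambda^t is a univariate polynomial in mu, to which root
    counting applies. *)
Lemma coef_hornerC p (a : K) t : p.[a%:P]`_t = ((swapXY p)`_t).[a].
Proof.
by rewrite -[in LHS](swapXYK p) horner_swapXY coef_map.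
Qed.

Lemma size_coef_swapXY p d t :
  total_degree_le d p -> (size ((swapXY p)`_t)%R <= (d - t).+1)%N.
Proof.
by move=> pP; apply/leq_sizeP => s ds; rewrite coef_swapXY pP //; lia.
Qed.

End TotalDegree.

Lemma map_chi (K K' : comNzRingType) (f : {rmorphism K -> K'}) (m r : nat)
    (A : 'M[K]_m) (B C : 'M[K]_(m, r)) :
  chi (map_mx f A) (map_mx f B) (map_mx f C) =
  map_poly (map_poly f) (chi A B C).
Proof.
rewrite /chi -det_map_mx; congr (\det _).
rewrite map_trmx -map_mxM; apply/matrixP => i j.
rewrite !mxE !rmorphB rmorphM rmorphMn /= !map_polyC /= !map_polyC /=.
by rewrite map_polyX map_polyX.
Qed.

Lemma total_degree_le_no_cross_terms (K : idomainType) (m : nat)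
    (p : {poly {poly K}}) (mu : 'I_m -> K) :
  total_degree_le m p -> injective mu ->
  (forall j1 j2, p.[(mu j1)%:P] = p.[(mu j2)%:P]) ->
  forall s t, (0 < s)%N -> (0 < t)%N -> p`_s`_t = 0.
Proof.
case: m mu => [|m] mu pP mu_inj mu_eq s t s_gt0 t_gt0.
  (* With no sample points the degree bound is 0, which [s + t] exceeds. *)
  by apply: pP; rewrite addn_gt0 s_gt0.
pose q := (swapXY p)`_t; pose c := q.[mu ord0].
suff /eqP q_c : q - c%:P == 0.
  rewrite -coef_swapXY -/q (subr0_eq q_c) coefC.
  by case: s s_gt0.
(* Here [t > 0] is essential: it brings the size of [q] down to the number of sample points. *)
have: (size (q - c%:P)%R <= m.+1)%N.
  rewrite (leq_trans (size_polyD _ _)) // size_polyN geq_max.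
  rewrite (leq_trans (size_polyC_leq1 _)) // andbT.
  by rewrite (leq_trans (size_coef_swapXY t pP)) //; lia.
(* If nonzero, [q - c%:P] would have all the distinct values of [mu] as roots, hence a larger
   size. *)
apply: contraLR => q_neq; rewrite -ltnNge.
have -> : m.+1 = size (codom mu) by rewrite size_codom card_ord.
apply: max_poly_roots => //; last by rewrite map_inj_uniq ?enum_uniq.
apply/allP => _ /codomP[j ->].
rewrite rootE hornerD hornerN hornerC /c /q -!coef_hornerC.
by rewrite (mu_eq j ord0) subrr.
Qed.

(** The roots fix a monic polynomial of degree [N], and the remaining scalar factor is the
    coefficient at [N]; this also covers a zero scalar. *)
Lemma lists_roots_eq (K : comNzRingType) (N : nat) (p q : {poly K})
    (s s' : 'I_N -> K) :
  lists_roots p s -> lists_roots q s' -> perm_eq (codom s) (codom s') ->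
  p`_N = q`_N -> p = q.
Proof.
have coefN c (u : 'I_N -> K) : (c *: \prod_k ('X - (u k)%:P))`_N = c.
  have := monic_prod_XsubC (index_enum 'I_N) xpredT u.
  rewrite monicE lead_coefE size_prod_XsubC -[index_enum _]enumT size_enum_ord.
  by rewrite coefZ => /eqP ->; rewrite mulr1.
have prod_codom (u : 'I_N -> K) :
    \prod_k ('X - (u k)%:P) = \prod_(x <- codom u) ('X - x%:P).
  by rewrite big_map enumT.
move=> -> -> /(perm_big _) ss'; rewrite !coefN => ->.
by rewrite !prod_codom ss'.
Qed.

Theorem lemma3 (R : realType) (n m r : nat)
    (n_ge1 : (1 <= n)%N) (m_ge1 : (1 <= m)%N) (r_ge1 : (1 <= r)%N)
    (A : 'M[R]_m) (B C : 'M[R]_(m, r))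
    (L : 'M[R]_n) (L_laplacian : is_laplacian L)
    (lam : 'I_n -> R[i])
    (lamP : lists_eigenvalues (complexify L) lam)
    (mu : 'I_n -> 'I_m -> R[i])
    (muP : forall i : 'I_n,
       lists_eigenvalues
         (complexify A - lam i *: (complexify B *m (complexify C)^T)) (mu i))
    (lam3 : 'I_n -> 'I_m -> 'I_(\rank (B *m C^T)) -> R[i])
    (lam3P : forall (i : 'I_n) (j : 'I_m),
       lists_roots
         (chi (complexify A) (complexify B) (complexify C)).[(mu i j)%:P]
         (lam3 i j))
    (full_rank : \rank (B *m C^T) = m)
    (H : exists i : 'I_n, forall j1 j2 : 'I_m, j1 != j2 ->
       [/\ mu i j1 != mu i j2, mu i j1 != 0, mu i j2 != 0
         & perm_eq (codom (lam3 i j1)) (codom (lam3 i j2))]) :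
  forall s t : nat, (0 < s)%N -> (0 < t)%N -> (chi A B C)`_s`_t = 0.
Proof.
pose f := real_complex R.
pose p := chi (complexify A) (complexify B) (complexify C).
have p_deg : total_degree_le m p by apply: total_degree_le_chi.
have p_coef_m a b : p.[a%:P]`_m = p.[b%:P]`_m.
  have := size_coef_swapXY m p_deg; rewrite subnn => /size1_polyC pm.
  by rewrite !coef_hornerC pm !hornerC.
have [i Hi] := H.
have mu_inj : injective (mu i).
  move=> j1 j2 mu12; apply/eqP/negPn/negP => /Hi[].
  by rewrite mu12 eqxx.
have p_eq j1 j2 : p.[(mu i j1)%:P] = p.[(mu i j2)%:P].
  have [->//|/Hi[_ _ _ lam12]] := eqVneq j1 j2.
  apply: lists_roots_eq (lam3P i j1) (lam3P i j2) lam12 _.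
  (* The root lists have length the rank of [B *m C^T]; full rank makes the coefficient to compare
     that of lambda^m, which is constant in mu. *)
  by rewrite full_rank; apply: p_coef_m.
(* The coefficients of the complexified polynomial are the images of the real ones under the
   injective [f], so vanishing descends to [R]. *)
move=> s t s_gt0 t_gt0; apply: (fmorph_inj f); rewrite rmorph0.
rewrite -(total_degree_le_no_cross_terms p_deg mu_inj p_eq s_gt0 t_gt0).
by rewrite /p map_chi !coef_map.
Qed.
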